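(* Let $n\ge 1$, let $C_n = [0,1]^n$ be the hypercube in $n$ dimensions and let $S(C_n) \in \mathbb{R}^{2n \times 2^n}$ be its slack matrix. Then \[ \operatorname{rank}_+(S(C_n)) = \left(\frac{\nu_+^{[0]}(S(C_n))}{\|S(C_n)\|_F}\right)^2 = 2n. \]
   Context: The nonnegative rank $\operatorname{rank}_+(A)$ of an entrywise nonnegative matrix $A\in\mathbb{R}^{p\times q}$ is the smallest integer $r$ such that $A=UV$ with $U\in\mathbb{R}^{p\times r}$ and $V\in\mathbb{R}^{r\times q}$ both entrywise nonnegative. The slack matrix of a polytope with facet inequalities $b_i-a_i^{T}x\ge 0$ ($i=1,\dots,f$) and vertices $x_1,\dots,x_v$ is the $f\times v$ matrix with entries $b_i-a_i^{T}x_j$. For $C_n$ the facet inequalities are $x_k\ge 0$ and $1-x_k\ge 0$ for $k=1,\dots,n$, and the vertices are the points of $\{0,1\}^n$; so $S(C_n)$ is the $0/1$ matrix whose entry for facet $F$ and vertex $V$ is $1$ if $V\notin F$ and $0$ if $V\in F$. For an entrywise nonnegative matrix $A\in\mathbb{R}^{p\times q}$, \[ \nu_+^{[0]}(A) = \max_{W \in \mathbb{R}^{p \times q}} \left\{ \langle A, W \rangle : \begin{bmatrix} I & -W\\ -W^{T} & I \end{bmatrix} \in \mathcal{N}^{p+q} + \mathcal{S}^{p+q}_+ \right\} \] (the optimal value of this program), where $\mathcal{S}^{N}_+$ is the cone of $N\times N$ real symmetric positive semidefinite matrices, $\mathcal{N}^{N}$ is the cone of $N\times N$ symmetric entrywise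 nonnegative matrices, and $\langle X,Y\rangle = \operatorname{trace}(X^{T}Y)$. $\|\cdot\|_F$ is the Frobenius norm. *)

(* Defs.v *)
(* Libraries: MathComp and MathComp-Analysis. *)
From HB Require Import structures.
From mathcomp Require Import all_boot all_order all_algebra.
From mathcomp Require Import boolp classical_sets reals.

Set Implicit Arguments.
Unset Strict Implicit.
Unset Printing Implicit Defensive.

Import Order.TTheory GRing.Theory Num.Theory.
Local Open Scope ring_scope.
Local Open Scope classical_set_scope.

Section Matrices.
Variable R : realType.

Definition nonnegmx (p q : nat) : set 'M[R]_(p, q) :=
  [set A | forall i j, 0 <= A i j].

Definition sym_nonnegmx (N : nat) : set 'M[R]_N :=
  [set A | A^T = A /\ nonnegmx A].

Definition psdmx (N : nat) : set 'M[R]_N :=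
  [set A | A^T = A /\ forall x : 'cV[R]_N, 0 <= (x^T *m A *m x) 0 0].

Definition mxdot (p q : nat) (A B : 'M[R]_(p, q)) : R := \tr (A^T *m B).

Definition frobenius_norm (p q : nat) (A : 'M[R]_(p, q)) : R :=
  Num.sqrt (mxdot A A).

Definition nonneg_factorization (p q : nat) (A : 'M[R]_(p, q)) (r : nat) :=
  exists (U : 'M[R]_(p, r)) (V : 'M[R]_(r, q)),
    [/\ nonnegmx U, nonnegmx V & A = U *m V].

Definition is_nonneg_rank (p q : nat) (A : 'M[R]_(p, q)) : set nat :=
  [set r | nonneg_factorization A r /\
           forall s, nonneg_factorization A s -> (r <= s)%N].

(* A smallest r exists as soon as A is entrywise nonnegative (nonneg_rankP
   below); the default value 0 concerns matrices with a negative entry. *)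
Definition nonneg_rank (p q : nat) (A : 'M[R]_(p, q)) : nat :=
  xget 0%N (is_nonneg_rank A).

Definition nu0_feasible (p q : nat) : set 'M[R]_(p, q) :=
  [set W | exists (P S : 'M[R]_(p + q)),
     [/\ sym_nonnegmx P, psdmx S & block_mx 1%:M (- W) (- W^T) 1%:M = P + S]].

Definition nu0_values (p q : nat) (A : 'M[R]_(p, q)) : set R :=
  [set mxdot A W | W in @nu0_feasible p q].

Definition is_nu0 (p q : nat) (A : 'M[R]_(p, q)) : set R :=
  [set m | nu0_values A m /\ forall y, nu0_values A y -> y <= m].

(* The maximum (not merely the supremum) of the program: a nonzero value of
   nu0 A is necessarily attained. The default value is 0. *)
Definition nu0 (p q : nat) (A : 'M[R]_(p, q)) : R := xget 0 (is_nu0 A).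

(* Facet inequalities b - a *m x >= 0 (one row of a and b per facet) and
   vertices the columns of X. *)
Definition slack_mx (f n v : nat) (a : 'M[R]_(f, n)) (b : 'cV[R]_f)
    (X : 'M[R]_(n, v)) : 'M[R]_(f, v) :=
  \matrix_(i, j) (b i 0 - (a *m X) i j).

Lemma nonneg_rankP (p q : nat) (A : 'M[R]_(p, q)) :
  nonnegmx A -> is_nonneg_rank A (nonneg_rank A).
Proof.
move=> A0; have ex : exists r, `[< nonneg_factorization A r >].
  exists p; apply/asboolP; exists 1%:M, A; split => //; last by rewrite mul1mx.
  by move=> i j; rewrite mxE ler0n.
case: (ex_minnP ex) => r /asboolP rA minr.
by apply: (@xgetPex _ 0%N (is_nonneg_rank A)); exists r; split => // s /asboolP /minr.
Qed.

End Matrices.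

Section Hypercube.
Variable R : realType.

Definition hypercube (n : nat) : set 'cV[R]_n :=
  [set x | forall k, 0 <= x k 0 <= 1].

(* Rows 0 .. n-1 encode x_k >= 0, rows n .. 2n-1 encode 1 - x_k >= 0. *)
Definition cube_facets_lhs (n : nat) : 'M[R]_(n + n, n) :=
  col_mx (- 1%:M) 1%:M.

Definition cube_facets_rhs (n : nat) : 'cV[R]_(n + n) :=
  col_mx (const_mx 0) (const_mx 1).

Lemma card_cube_points (n : nat) : #|{ffun 'I_n -> bool}| = (2 ^ n)%N.
Proof. by rewrite card_ffun card_bool card_ord. Qed.

Definition cube_point (n : nat) (j : 'I_(2 ^ n)) : {ffun 'I_n -> bool} :=
  enum_val (cast_ord (esym (card_cube_points n)) j).

Definition cube_vertices (n : nat) : 'M[R]_(n, 2 ^ n) :=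
  \matrix_(k, j) (cube_point j k)%:R.

Definition slack_cube (n : nat) : 'M[R]_(n + n, 2 ^ n) :=
  slack_mx (cube_facets_lhs n) (cube_facets_rhs n) (cube_vertices n).

Lemma hypercubeE (n : nat) :
  @hypercube n =
  [set x | forall i, 0 <= slack_mx (cube_facets_lhs n) (cube_facets_rhs n) x i 0].
Proof.
apply/seteqP; split=> x /= xP.
  move=> i; rewrite mxE /cube_facets_lhs /cube_facets_rhs mul_col_mx mulNmx mul1mx.
  by case: (split_ordP i) => k ->; case/andP: (xP k) => x0 x1;
    rewrite ?col_mxEu ?col_mxEd !mxE ?opprK ?add0r // subr_ge0.
move=> k; apply/andP; split; [have := xP (lshift n k)|have := xP (rshift n k)];
  rewrite mxE /cube_facets_lhs /cube_facets_rhs mul_col_mx mulNmx mul1mx.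
  by rewrite !col_mxEu !mxE opprK add0r.
by rewrite !col_mxEd !mxE subr_ge0.
Qed.

Lemma cube_point_bij (n : nat) : bijective (@cube_point n).
Proof.
apply: inj_card_bij; last by rewrite card_cube_points card_ord.
by move=> i j /enum_val_inj /cast_ord_inj.
Qed.

Lemma slack_cubeE (n : nat) :
  slack_cube n = col_mx (\matrix_(k, j) (cube_point j k)%:R)
                        (\matrix_(k, j) (~~ cube_point j k)%:R).
Proof.
apply/matrixP => i j.
rewrite mxE /cube_facets_lhs /cube_facets_rhs mul_col_mx mulNmx mul1mx.
case: (split_ordP i) => k ->; rewrite ?col_mxEu ?col_mxEd !mxE.
  by rewrite opprK add0r.
by case: (cube_point j k); rewrite ?subrr ?subr0.
Qed.

End Hypercube.

(* Main.v *)
(** The bound [nu0 A <= sqrt r * ||A||_F] holds for every nonnegative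
    factorization [A = \sum_(l < r) u_l v_l^T]: testing the constraint on the
    nonnegative vectors [(s u_l, t v_l)] gives [u_l^T W v_l <= |u_l| |v_l|],
    and Cauchy-Schwarz together with nonnegativity of the cross terms of
    [||A||_F^2] concludes.  For the cube it is attained, with [r = 2n], by
    [W = c (2 S(C_n) - J)], [c^2 = 2 / 2^n]: after subtracting the nonnegative
    matrix that swaps opposite facets and antipodal vertices, the remaining
    matrix is a sum of two Gram matrices, because the rows of the [n x 2^n]
    sign matrix are orthogonal and odd under the antipodal map. *)
Require Import Defs.
From mathcomp Require Import all_boot all_order all_algebra.
From mathcomp Require Import reals.
From mathcomp Require Import classical_sets ring lra.
Import GRing.Theory Num.Theory.
Import Order.TTheory.
Local Open Scope ring_scope.

Set Implicit Arguments.
Unset Strict Implicit.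

(** * Upper bound on the program from a nonnegative factorization *)

Section NonnegativeFactorizationBound.
Variable R : realType.

Lemma mxdotE (p q : nat) (A B : 'M[R]_(p, q)) :
  mxdot A B = \sum_i \sum_j A i j * B i j.
Proof.
rewrite /mxdot /mxtrace exchange_big; apply: eq_bigr => j _.
by rewrite mxE; apply: eq_bigr => i _; rewrite mxE.
Qed.

Lemma mxdot_ge0 (p q : nat) (A : 'M[R]_(p, q)) : 0 <= mxdot A A.
Proof.
by rewrite mxdotE; do 2!apply: sumr_ge0 => ? _; rewrite -expr2 sqr_ge0.
Qed.

Lemma mxdot_eq0 (p q : nat) (A : 'M[R]_(p, q)) : mxdot A A = 0 -> A = 0.
Proof.
rewrite mxdotE => /eqP; rewrite psumr_eq0; last first.
  by move=> i _; apply: sumr_ge0 => j _; rewrite -expr2 sqr_ge0.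
move=> /allP A0; apply/matrixP => i j; rewrite mxE.
have := A0 i (mem_index_enum i); rewrite /= psumr_eq0; last first.
  by move=> k _; rewrite -expr2 sqr_ge0.
by move=> /allP /(_ j (mem_index_enum j)) /=; rewrite mulf_eq0 orbb => /eqP.
Qed.

Lemma mxdot_col (N : nat) (x : 'cV[R]_N) : mxdot x x = (x^T *m x) 0 0.
Proof. by rewrite /mxdot /mxtrace big_ord1. Qed.

(** Cauchy-Schwarz against the all-ones vector: the gap between the two sides is half the double sum
    of the squares [(b l - b m) ^+ 2]. *)
Lemma sqr_sum_le (r : nat) (b : 'I_r -> R) :
  (\sum_l b l) ^+ 2 <= r%:R * \sum_l b l ^+ 2.
Proof.
have : 0 <= \sum_l \sum_m (b l - b m) ^+ 2.
  by do 2!apply: sumr_ge0 => ? _; rewrite sqr_ge0.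
have -> : \sum_l \sum_m (b l - b m) ^+ 2 =
    2 * (r%:R * (\sum_l b l ^+ 2) - (\sum_l b l) ^+ 2).
  under eq_bigr => l _.
    under eq_bigr => m _ do rewrite sqrrB.
    rewrite big_split sumrB /= sumr_const card_ord.
    rewrite sumrMnl -mulr_sumr.
    over.
  rewrite big_split sumrB /= sumr_const card_ord !sumrMnl -mulr_suml.
  by set x := \sum_l b l; set y := \sum_l _; rewrite -[y *+ r]mulr_natl; ring.
lra.
Qed.

Lemma sumr_sqr_le (r : nat) (b : 'I_r -> R) :
  (forall l, 0 <= b l) -> \sum_l b l ^+ 2 <= (\sum_l b l) ^+ 2.
Proof.
move=> b0; rewrite expr2 mulr_suml; apply: ler_sum => l _.
rewrite expr2 ler_wpM2l // (bigD1 l) //= lerDl.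
by apply: sumr_ge0.
Qed.

(** The block matrix is tested on [x = col_mx u v]: [P] contributes a nonnegative term because [x]
    is entrywise nonnegative, [S] because it is positive semidefinite. *)
Lemma feasible_form_le (p q : nat) (W : 'M[R]_(p, q))
    (u : 'cV[R]_p) (v : 'cV[R]_q) :
  nu0_feasible W -> nonnegmx u -> nonnegmx v ->
  2 * (u^T *m W *m v) 0 0 <= mxdot u u + mxdot v v.
Proof.
move=> [P [S [[_ P0] [_ S0] eqPS]]] u0 v0.
pose x := col_mx u v.
have x0 i : 0 <= x i 0 by rewrite mxE; case: split.
have : 0 <= (x^T *m (P + S) *m x) 0 0.
  rewrite mulmxDr mulmxDl mxE addr_ge0 //.
  rewrite mxE sumr_ge0 // => j _; rewrite mulr_ge0 // mxE sumr_ge0 // => i _.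
  by rewrite mulr_ge0 // mxE.
rewrite -eqPS /x tr_col_mx mul_row_block mul_row_col !mulmx1.
rewrite !mulmxDl !mulmxN !mulNmx.
have -> : v^T *m W^T *m u = u^T *m W *m v.
  apply/matrixP => i j; rewrite !ord1 -[in RHS](trmxK (u^T *m W *m v)) [RHS]mxE.
  by rewrite !trmx_mul trmxK mulmxA.
have entryD (A B : 'M[R]_1) : (A + B) 0 0 = A 0 0 + B 0 0 by rewrite mxE.
have entryN (A : 'M[R]_1) : (- A) 0 0 = - A 0 0 by rewrite mxE.
by rewrite !mxdot_col !(entryD, entryN); lra.
Qed.

Lemma feasible_form_le_norm (p q : nat) (W : 'M[R]_(p, q))
    (u : 'cV[R]_p) (v : 'cV[R]_q) :
  nu0_feasible W -> nonnegmx u -> nonnegmx v ->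
  (u^T *m W *m v) 0 0 <= frobenius_norm u * frobenius_norm v.
Proof.
move=> fW u0 v0; rewrite /frobenius_norm.
set s := Num.sqrt (mxdot u u); set t := Num.sqrt (mxdot v v).
have s2 : s ^+ 2 = mxdot u u by rewrite sqr_sqrtr // mxdot_ge0.
have t2 : t ^+ 2 = mxdot v v by rewrite sqr_sqrtr // mxdot_ge0.
have [uz|un0] := eqVneq u 0.
  by rewrite uz trmx0 !mul0mx mxE mulr_ge0 // sqrtr_ge0.
have [vz|vn0] := eqVneq v 0.
  by rewrite vz !mulmx0 mxE mulr_ge0 // sqrtr_ge0.
have s0 : 0 < s.
  rewrite lt_def sqrtr_ge0 andbT; apply: contra_neq un0 => sz.
  by apply: mxdot_eq0; rewrite -s2 sz expr0n.
have t0 : 0 < t.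
  rewrite lt_def sqrtr_ge0 andbT; apply: contra_neq vn0 => tz.
  by apply: mxdot_eq0; rewrite -t2 tz expr0n.
(* Scaling each vector by the norm of the other balances the two squared norms, both equal to
   [s ^+ 2 * t ^+ 2]; dividing by [2 * (s * t)] then leaves the product of the norms. *)
have := @feasible_form_le _ _ W (t *: u) (s *: v) fW.
have -> : ((t *: u)^T *m W *m (s *: v)) 0 0 = s * t * (u^T *m W *m v) 0 0.
  by rewrite -scalemxAr [(t *: u)^T]linearZ /= -!scalemxAl scalerA mxE.
have mxdotZ k (a : R) (w : 'cV[R]_k) : mxdot (a *: w) (a *: w) = a ^+ 2 * mxdot w w.
  by rewrite /mxdot [(a *: w)^T]linearZ /= -scalemxAl -scalemxAr scalerA mxtraceZ expr2.
rewrite !mxdotZ -s2 -t2 => le_st.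
rewrite -(ler_pM2l (mulr_gt0 s0 t0)).
suff : 2 * (s * t * (u^T *m W *m v) 0 0) <= t ^+ 2 * s ^+ 2 + s ^+ 2 * t ^+ 2.
  by move: (_ 0 0) => z; nra.
by apply: le_st => i j; rewrite mxE mulr_ge0 // ltW.
Qed.

Lemma nu0_feasible_le (p q r : nat) (A W : 'M[R]_(p, q)) :
  nonneg_factorization A r -> nu0_feasible W ->
  mxdot A W <= Num.sqrt r%:R * frobenius_norm A.
Proof.
move=> [U [V [U0 V0 ->]]] fW.
pose b l := frobenius_norm (col l U) * frobenius_norm (row l V)^T.
have b0 l : 0 <= b l by rewrite mulr_ge0 // sqrtr_ge0.
have leWb : mxdot (U *m V) W <= \sum_l b l.
  have -> : mxdot (U *m V) W =
      \sum_l ((col l U)^T *m W *m (row l V)^T) 0 0.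
    rewrite mxdotE.
    under [RHS]eq_bigr => l _.
      rewrite mxE; under eq_bigr => j _ do rewrite !mxE mulr_suml.
      over.
    rewrite /= [RHS]exchange_big /= exchange_big /=; apply: eq_bigr => j _.
    rewrite exchange_big /=; apply: eq_bigr => i _.
    rewrite mxE mulr_suml; apply: eq_bigr => l _.
    by rewrite !mxE; ring.
  apply: ler_sum => l _; apply: feasible_form_le_norm => // i j.
    by rewrite mxE.
  by rewrite !mxE.
apply: (le_trans leWb).
rewrite /frobenius_norm -sqrtrM ?ler0n //.
have sb0 : 0 <= \sum_l b l by apply: sumr_ge0.
rewrite -(ger0_norm sb0) -sqrtr_sqr ler_wsqrtr //.
apply: (le_trans (sqr_sum_le b)); rewrite ler_wpM2l ?ler0n //.
(* [b l] is the Frobenius norm of the rank-one term [col l U *m row l V], so the comparison with the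
   squared norm of [U *m V] can be made entry by entry. *)
have -> : \sum_l b l ^+ 2 = \sum_i \sum_j \sum_l (U i l * V l j) ^+ 2.
  under [RHS]eq_bigr => i _ do rewrite exchange_big.
  rewrite [RHS]exchange_big /=; apply: eq_bigr => l _.
  rewrite exprMn !sqr_sqrtr ?mxdot_ge0 // !mxdotE mulr_suml.
  apply: eq_bigr => i _; rewrite big_ord1 mulr_sumr.
  by apply: eq_bigr => j _; rewrite big_ord1 !mxE; ring.
rewrite mxdotE; do 2!apply: ler_sum => ? _.
rewrite -expr2 mxE; apply: sumr_sqr_le => l.
exact: mulr_ge0.
Qed.

Lemma is_nu0_unique (p q : nat) (A : 'M[R]_(p, q)) (m : R) :
  is_nu0 A m -> nu0 A = m.
Proof.
move=> mA; apply: xget_unique => // y [yA ymax].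
by apply/eqP; rewrite eq_le mA.2 // ymax //; case: mA.
Qed.

Lemma psdmx_gram (N k : nat) (B : 'M[R]_(k, N)) : psdmx (B^T *m B).
Proof.
split; first by rewrite trmx_mul trmxK.
move=> x; rewrite mulmxA -mulmxA -trmx_mul -mxdot_col; exact: mxdot_ge0.
Qed.

End NonnegativeFactorizationBound.

(** * Sign vectors and the antipodal map of the cube *)

Section CubeWitness.
Variables (R : realType) (n : nat).

(** The exponent is negated so that coordinate 1 gets sign +1; stacking this matrix over its
    opposite then gives twice the slack matrix minus the all-ones matrix. *)
Definition sign_mx : 'M[R]_(n, 2 ^ n) :=
  \matrix_(k, j) (-1) ^+ (~~ cube_point j k).

(** The permutation matrix of the antipodal map, encoded by a symmetric relation between vertices so
    that no inverse of the enumeration enters. *)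
Definition antipodal_mx : 'M[R]_(2 ^ n) :=
  \matrix_(i, j) [forall k, cube_point i k != cube_point j k]%:R.

Lemma antipode_exists (j : 'I_(2 ^ n)) :
  exists i : 'I_(2 ^ n), forall k, cube_point i k = ~~ cube_point j k.
Proof.
have [g _ gK] := cube_point_bij n.
by exists (g [ffun k => ~~ cube_point j k]) => k; rewrite gK ffunE.
Qed.

Lemma antipodal_col (i j : 'I_(2 ^ n)) :
  (forall k, cube_point i k = ~~ cube_point j k) ->
  forall l, antipodal_mx l j = (l == i)%:R.
Proof.
move=> ij l; rewrite mxE; congr (_%:R); congr nat_of_bool.
apply/forallP/eqP => [lj|-> k]; last by rewrite ij; case: (cube_point _ _).
apply: (bij_inj (cube_point_bij n)); apply/ffunP => k.
by have := lj k; rewrite ij; case: (cube_point l k); case: (cube_point j k).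
Qed.

Lemma antipodal_mxT : antipodal_mx^T = antipodal_mx.
Proof.
apply/matrixP => i j; rewrite !mxE; congr (_%:R); congr nat_of_bool.
by apply: eq_forallb => k; rewrite eq_sym.
Qed.

Lemma mul_antipodal_mx p (B : 'M[R]_(p, 2 ^ n)) (i j : 'I_(2 ^ n)) k :
  (forall l, cube_point i l = ~~ cube_point j l) ->
  (B *m antipodal_mx) k j = B k i.
Proof.
move=> ij; rewrite mxE (bigD1 i) //= (antipodal_col ij) eqxx mulr1 big1 ?addr0 //.
by move=> l li; rewrite (antipodal_col ij) (negbTE li) mulr0.
Qed.

Lemma antipodal_mxK : antipodal_mx *m antipodal_mx = 1%:M.
Proof.
apply/matrixP => i j; have [j' jj'] := antipode_exists j.
rewrite (mul_antipodal_mx _ _ jj') (@antipodal_col j) ?mxE // => k.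
by rewrite jj' negbK.
Qed.

Lemma sign_mx_antipodal : sign_mx *m antipodal_mx = - sign_mx.
Proof.
apply/matrixP => k j; have [j' jj'] := antipode_exists j.
rewrite (mul_antipodal_mx _ _ jj') !mxE jj'.
by case: (cube_point _ _); rewrite ?expr1 ?expr0 ?opprK.
Qed.

Lemma sign_mx_orthogonal : sign_mx *m sign_mx^T = (2 ^ n)%:R%:M.
Proof.
apply/matrixP => k l; rewrite !mxE.
under eq_bigr => j _ do rewrite !mxE.
have [->|kl] := eqVneq k l.
  under eq_bigr => j _ do rewrite -expr2 sqrr_sign.
  by rewrite sumr_const card_ord.
rewrite mulr0n.
have [g cpK gK] := cube_point_bij n.
(* Flipping coordinate [k] permutes the vertices, changes the sign in row [k] and keeps the sign in
   row [l], so the inner product equals its own opposite. *)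
pose flip (f : {ffun 'I_n -> bool}) : {ffun 'I_n -> bool} :=
  [ffun i => f i (+) (i == k)].
have flipK : involutive flip.
  by move=> f; apply/ffunP => i; rewrite !ffunE -addbA addbb addbF.
pose F := fun j : 'I_(2 ^ n) =>
  (-1) ^+ (~~ cube_point j k) * (-1) ^+ (~~ cube_point j l) : R.
suff : \sum_j F j = - \sum_j F j by rewrite /F; lra.
rewrite [LHS](reindex (fun j => g (flip (cube_point j)))) /=; last first.
  by exists (fun j => g (flip (cube_point j))) => j _; rewrite gK flipK cpK.
rewrite -sumrN; apply: eq_bigr => j _; rewrite /F gK !ffunE eqxx eq_sym.
rewrite (negbTE kl) addbF addbT -mulNr; congr (_ * _).
by case: (cube_point _ _); rewrite ?expr1 ?expr0 ?opprK.
Qed.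

(** * A feasible matrix for the cube *)

Definition cube_scale : R := Num.sqrt (2 / (2 ^ n)%:R).

Lemma pow2_gt0 : 0 < (2 ^ n)%:R :> R.
Proof. by rewrite ltr0n expn_gt0. Qed.

(** This identity dictates the scale: with the orthogonality of the rows, it makes [cube_scale ^+ 2
    *: (sign_mx^T *m sign_mx)] twice an orthogonal projector. *)
Lemma cube_scale_sqr : cube_scale ^+ 2 * (2 ^ n)%:R = 2.
Proof.
rewrite sqr_sqrtr ?divr_ge0 ?ler0n // divfK //.
by rewrite gt_eqF // pow2_gt0.
Qed.

Definition cube_witness : 'M[R]_(n + n, 2 ^ n) :=
  cube_scale *: col_mx sign_mx (- sign_mx).

(** Twice the orthogonal projector onto those vectors, odd under the antipodal map, that are
    orthogonal to the rows of [sign_mx]. *)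
Definition odd_residual : 'M[R]_(2 ^ n) :=
  1%:M - antipodal_mx - cube_scale ^+ 2 *: (sign_mx^T *m sign_mx).

Lemma odd_residualT : odd_residual^T = odd_residual.
Proof.
by rewrite /odd_residual !linearB /= linearZ /= trmx_mul trmxK trmx1 antipodal_mxT.
Qed.

(** Both [E] and [Q] are twice orthogonal projectors, and the range of [Q] lies in that of [E] since
    the rows of [sign_mx] are odd; hence [E - Q] is again twice a projector. *)
Lemma odd_residual_sqr : odd_residual *m odd_residual = 2 *: odd_residual.
Proof.
set c2 := cube_scale ^+ 2.
pose Q := c2 *: (sign_mx^T *m sign_mx); pose E := 1%:M - antipodal_mx.
have QE : Q *m E = 2 *: Q.
  rewrite /E mulmxBr mulmx1 /Q -scalemxAl -mulmxA sign_mx_antipodal mulmxN.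
  by rewrite scalerN opprK scaler_nat mulr2n.
have ET : E^T = E by rewrite /E linearB /= trmx1 antipodal_mxT.
have QT : Q^T = Q by rewrite /Q linearZ /= trmx_mul trmxK.
have EQ : E *m Q = 2 *: Q.
  by apply: trmx_inj; rewrite trmx_mul ET QT QE [RHS]linearZ /= QT.
have QQ : Q *m Q = 2 *: Q.
  rewrite {1 2}/Q -scalemxAl -scalemxAr -mulmxA (mulmxA sign_mx).
  rewrite sign_mx_orthogonal mul_scalar_mx -scalemxAr !scalerA.
  by rewrite /c2 cube_scale_sqr mulrC.
have EE : E *m E = 2 *: E.
  rewrite {1 2}/E mulmxBr mulmx1 mulmxBl mul1mx antipodal_mxK /E.
  by rewrite opprB scaler_nat mulr2n.
have -> : odd_residual = E - Q by [].
clearbody E Q; rewrite mulmxBl !mulmxBr EE EQ QE QQ subrr subr0.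
by rewrite -scalerBr.
Qed.

Lemma cube_witness_feasible : nu0_feasible cube_witness.
Proof.
pose P : 'M[R]_((n + n) + 2 ^ n) :=
  block_mx (block_mx 0 1%:M 1%:M 0) 0 0 antipodal_mx.
pose D : 'M[R]_(n + n, n) := col_mx 1%:M (- 1%:M).
(* The Gram matrix of [K] yields the off-diagonal blocks, and its facet block [D *m D^T] is the
   identity minus the facet swap in [P]. Only the vertex block still lacks [odd_residual], which [G]
   supplies. *)
pose K : 'M[R]_(n, (n + n) + 2 ^ n) := row_mx D^T (- (cube_scale *: sign_mx)).
pose G : 'M[R]_(2 ^ n, (n + n) + 2 ^ n) := row_mx 0 odd_residual.
(* The factor cancels the 2 in [odd_residual_sqr], so that the Gram matrix of the second block has
   [odd_residual] itself as its vertex block. *)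
pose B := col_mx K ((Num.sqrt 2)^-1 *: G).
exists P, (B^T *m B); split; last 2 first.
- exact: psdmx_gram.
- have WE : cube_witness = D *m (cube_scale *: sign_mx).
    by rewrite /D mul_col_mx mul1mx mulNmx mul1mx -scalerN -scale_col_mx.
  have DD : D *m D^T = block_mx 1%:M (- 1%:M) (- 1%:M) 1%:M.
    rewrite /D tr_col_mx mul_col_row linearN /= trmx1.
    by rewrite !mulNmx !mul1mx opprK.
  have GG : ((Num.sqrt 2)^-1 *: G)^T *m ((Num.sqrt 2)^-1 *: G) =
      block_mx 0 0 0 odd_residual.
    rewrite [_^T]linearZ /= -scalemxAl -scalemxAr scalerA -invfM -expr2.
    rewrite sqr_sqrtr ?ler0n // /G tr_row_mx mul_col_row trmx0 !mul0mx mulmx0.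
    rewrite odd_residualT odd_residual_sqr scale_block_mx !scaler0 scalerA.
    by rewrite mulVf ?scale1r // pnatr_eq0.
  have KK : K^T *m K = block_mx (D *m D^T) (- cube_witness) (- cube_witness^T)
      (cube_scale ^+ 2 *: (sign_mx^T *m sign_mx)).
    rewrite /K tr_row_mx mul_col_row trmxK [(- _)^T]linearN /=.
    rewrite !mulmxN !mulNmx opprK WE trmx_mul [(_ *: _)^T]linearZ /=.
    by rewrite -!scalemxAl -!scalemxAr scalerA expr2.
  rewrite /B tr_col_mx mul_row_col KK GG /P !add_block_mx DD.
  rewrite !add0r ![_ + 0]addr0 add_block_mx !add0r !subrr -scalar_mx_block.
  congr block_mx; rewrite /odd_residual.
  by rewrite [_ *: _ + _]addrC subrK addrC subrK.
split.
  by rewrite /P !tr_block_mx !trmx0 !trmx1 antipodal_mxT.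
move=> i j; rewrite /P; case: (split_ordP i) => i' ->; case: (split_ordP j) => j' ->.
- rewrite block_mxEul; case: (split_ordP i') => k ->; case: (split_ordP j') => l ->.
  + by rewrite block_mxEul mxE.
  + by rewrite block_mxEur mxE ler0n.
  + by rewrite block_mxEdl mxE ler0n.
  + by rewrite block_mxEdr mxE.
- by rewrite block_mxEur mxE.
- by rewrite block_mxEdl mxE.
- by rewrite block_mxEdr mxE ler0n.
Qed.

(** * Objective value and optimality for the slack matrix *)

Lemma slack_cube_norm2 :
  mxdot (slack_cube R n) (slack_cube R n) = (n * 2 ^ n)%:R.
Proof.
rewrite mxdotE slack_cubeE big_split_ord /= -big_split /=.
(* For each coordinate, a vertex lies on exactly one of the two opposite facets, so each pair of
   entries contributes 1. *)
under eq_bigr => k _.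
  rewrite -big_split /=.
  under eq_bigr => j _ do
    rewrite !col_mxEu !col_mxEd !mxE -!natrM !mulnb !andbb -natrD addnC addn_negb.
  over.
by rewrite /= !sumr_const !card_ord -mulrnA mulnC.
Qed.

(** The slack entries are 0 or 1, and wherever an entry is 1 the witness takes the value
    [cube_scale]. *)
Lemma slack_cube_witness :
  mxdot (slack_cube R n) cube_witness =
  cube_scale * mxdot (slack_cube R n) (slack_cube R n).
Proof.
rewrite !mxdotE mulr_sumr; apply: eq_bigr => i _.
rewrite mulr_sumr; apply: eq_bigr => j _.
rewrite slack_cubeE [cube_witness _ _]mxE; case: (split_ordP i) => k ->.
  by rewrite !col_mxEu !mxE; case: (cube_point _ _); rewrite /= ?expr0 ?expr1; ring.
by rewrite !col_mxEd !mxE; case: (cube_point _ _); rewrite /= ?expr0 ?expr1; ring.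
Qed.

Lemma slack_cube_ge0 : nonnegmx (slack_cube R n).
Proof.
move=> i j; rewrite slack_cubeE.
by case: (split_ordP i) => k ->; rewrite ?col_mxEu ?col_mxEd mxE ler0n.
Qed.

Lemma slack_cube_factorization : nonneg_factorization (slack_cube R n) (2 * n).
Proof.
rewrite mul2n -addnn; exists 1%:M, (slack_cube R n).
split; [|exact: slack_cube_ge0|by rewrite mul1mx].
by move=> i j; rewrite mxE ler0n.
Qed.

Lemma is_nu0_slack_cube :
  is_nu0 (slack_cube R n)
    (Num.sqrt (2 * n)%:R * frobenius_norm (slack_cube R n)).
Proof.
split; last first.
  by move=> _ [W fW <-]; apply: nu0_feasible_le => //; exact: slack_cube_factorization.
exists cube_witness; first exact: cube_witness_feasible.
rewrite slack_cube_witness /frobenius_norm -sqrtrM ?ler0n // slack_cube_norm2.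
(* Both sides are nonnegative, so it suffices to compare squares, which agree by
   [cube_scale_sqr]. *)
rewrite -[LHS]ger0_norm; last by rewrite mulr_ge0 ?sqrtr_ge0 ?ler0n.
rewrite -sqrtr_sqr; congr Num.sqrt.
by rewrite !natrM; have := cube_scale_sqr; nra.
Qed.

End CubeWitness.

Theorem proposition3 (R : realType) (n : nat) (hn : (1 <= n)%N) :
  (nonneg_rank (slack_cube R n))%:R =
    (nu0 (slack_cube R n) / frobenius_norm (slack_cube R n)) ^+ 2 :> R
  /\ (nu0 (slack_cube R n) / frobenius_norm (slack_cube R n)) ^+ 2
     = (2 * n)%:R :> R.
Proof.
(* Here [hn] enters: for [n = 0] the slack matrix has no rows and the quotient would be a division
   by zero. *)
have norm_gt0 : 0 < frobenius_norm (slack_cube R n).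
  by rewrite sqrtr_gt0 slack_cube_norm2 ltr0n muln_gt0 hn expn_gt0.
have [[W fW nuW] _] := is_nu0_slack_cube R n.
have -> : (nu0 (slack_cube R n) / frobenius_norm (slack_cube R n)) ^+ 2
    = (2 * n)%:R :> R.
  rewrite (is_nu0_unique (is_nu0_slack_cube R n)) mulfK ?gt_eqF //.
  by rewrite sqr_sqrtr ?ler0n.
split=> //; apply/eqP; rewrite eqr_nat eqn_leq.
have [fact minr] := nonneg_rankP (@slack_cube_ge0 R n).
rewrite minr /=; last exact: slack_cube_factorization.
(* A minimal factorization is tested on the optimal [W]; cancelling the positive norm leaves the
   square root of [2 * n] at most that of the nonnegative rank. *)
have := nu0_feasible_le fact fW.
by rewrite nuW ler_pM2r // ler_psqrt ?nnegrE ?ler0n // ler_nat.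
Qed.
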